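(* Consider the intrinsic identity family $A_\rho=I_{H_\rho}$, $\rho\in\mathcal R$. It admits an extension policy that is discontinuous at every density $\rho\in\mathcal R$ with $\lambda(\{\rho=0\})>0$, and it also admits an extension policy that is globally Lipschitz.
   Context: Let $X=\mathbb R^n$ ($n\ge 1$) with its Borel $\sigma$-algebra and Lebesgue measure $\lambda$; functions are complex-valued. Let $\mathcal H=L^2(X,\lambda)$ with norm $\|\cdot\|_2$; $\mathcal B(E)$ denotes the bounded linear operators on $E$. Let $\mathcal R=\{\rho\in L^1(X,\lambda):\rho\ge 0\ \lambda\text{-a.e.},\ \int_X\rho\,d\lambda=1\}$ with the $L^1$-metric. For $\rho\in\mathcal R$ let $H_\rho=L^2(X,\rho\,d\lambda)$ and $V_\rho=\{u\in\mathcal H:u=0\ \lambda\text{-a.e. on }\{\rho=0\}\}$. The map $U_\rho:H_\rho\to V_\rho$, $U_\rho[f]_\rho=\sqrt\rho\,f$, is unitary. For $A_\rho\in\mathcal B(H_\rho)$ let $A_\rho^\sharp=U_\rho A_\rho U_\rho^{-1}:V_\rho\to V_\rho$ (so $A_\rho^\sharp=I_{V_\rho}$ if $A_\rho=I_{H_\rho}$). An extension policy for a family $\{A_\rho\}_{\rho\in\mathcal R}$ is a choice, for every $\rho\in\mathcal R$, of an operator $\widetilde A_\rho\in\mathcal B(\mathcal H)$ with $\widetilde A_\rho|_{V_\rho}=A_\rho^\sharp$. It induces the map $\mathbb A(u,\rho)=(\widetilde A_\rho u,\rho)$ on $\mathcal H\times\mathcal R$, which carries the metric $d_\oplus((u,\rho),(v,\sigma))=\|u-v\|_2+\|\rho-\sigma\|_1$.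 The policy is called globally Lipschitz if $\mathbb A$ is globally Lipschitz for $d_\oplus$. It is called discontinuous at a density $\rho$ if $\mathbb A$ is discontinuous at $(u,\rho)$ for some $u\in\mathcal H$. *)

(* Defs.v *)
From HB Require Import structures.
From mathcomp Require Import all_boot all_order all_algebra.
From mathcomp Require Import ring_quotient complex.
From mathcomp Require Import all_classical all_reals all_analysis measurable_realfun.

Set Implicit Arguments.
Unset Strict Implicit.
Unset Printing Implicit Defensive.

Import Order.TTheory GRing.Theory Num.Theory.
Import numFieldNormedType.Exports.
Import Normc.

Local Open Scope classical_set_scope.
Local Open Scope ring_scope.

Section lebesgue_step.
Context (R : realType) (n : nat).
Variable m : {sigma_finite_measure set (n.-tuple R) -> \bar R}.

Definition tuple_cons (p : R * n.-tuple R) : n.+1.-tuple R :=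
  [tuple of p.1 :: p.2].

Lemma measurable_tuple_cons : measurable_fun [set: R * n.-tuple R] tuple_cons.
Proof. exact: measurable_cons. Qed.

Definition lebesgue_tupleS : set (n.+1.-tuple R) -> \bar R :=
  pushforward (@lebesgue_measure R \x m)%E tuple_cons.

Let mpre (A : set (n.+1.-tuple R)) :
  measurable A -> measurable (tuple_cons @^-1` A).
Proof. by move=> mA; rewrite -[X in measurable X]setTI; exact: measurable_tuple_cons. Qed.

Let lebesgue_tupleS0 : lebesgue_tupleS set0 = 0%E.
Proof. by rewrite /lebesgue_tupleS /pushforward preimage_set0 measure0. Qed.

Let lebesgue_tupleS_ge0 A : (0 <= lebesgue_tupleS A)%E.
Proof. by rewrite /lebesgue_tupleS /pushforward; exact: measure_ge0. Qed.

Let lebesgue_tupleS_sigma_additive : semi_sigma_additive lebesgue_tupleS.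
Proof.
move=> F mF tF mUF; rewrite /lebesgue_tupleS /pushforward preimage_bigcup.
apply: measure_semi_sigma_additive.
- by move=> k; exact: mpre.
- apply/trivIsetP => /= i j _ _ ij; rewrite -preimage_setI.
  by move/trivIsetP : tF => /(_ _ _ _ _ ij) ->//; rewrite preimage_set0.
- by rewrite -preimage_bigcup; exact: mpre.
Qed.

HB.instance Definition _ := isMeasure.Build _ _ _ lebesgue_tupleS
  lebesgue_tupleS0 lebesgue_tupleS_ge0 lebesgue_tupleS_sigma_additive.

Lemma lebesgue_tupleSE (A : set R) (B : set (n.-tuple R)) :
  measurable A -> measurable B ->
  lebesgue_tupleS [set t | A (thead t) /\ B [tuple of behead t]] =
  (lebesgue_measure A * m B)%E.
Proof.
move=> mA mB; rewrite /lebesgue_tupleS /pushforward -product_measure1E//.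
suff bK (x : R) (y : n.-tuple R) : [tuple of behead (tuple_cons (x, y))] = y.
  congr (_ _); apply/seteqP; split => -[x y] /=; by rewrite theadE bK.
exact/val_inj.
Qed.

Let lebesgue_tupleS_sigma_finite : sigma_finite setT lebesgue_tupleS.
Proof.
have /sigma_finiteP[F [TF ndF Foo]] := sigma_finiteT (@lebesgue_measure R).
have /sigma_finiteP[G [TG ndG Goo]] := sigma_finiteT m.
exists (fun k => [set t | F k (thead t) /\ G k [tuple of behead t]]).
  apply/seteqP; split => // t _.
  have [i _ Fi] : (\bigcup_i F i) (thead t) by rewrite -TF.
  have [j _ Gj] : (\bigcup_i G i) [tuple of behead t] by rewrite -TG.
  exists (maxn i j) => //=; split.
    by move: Fi; exact/subsetPset/ndF/leq_maxl.
  by move: Gj; exact/subsetPset/ndG/leq_maxr.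
move=> k; have [mF Foo'] := Foo k; have [mG Goo'] := Goo k; split.
  have -> : [set t : n.+1.-tuple R | F k (thead t) /\ G k [tuple of behead t]]
    = (fun t : n.+1.-tuple R => tnth t ord0) @^-1` F k `&`
      (fun t : n.+1.-tuple R => [tuple of behead t]) @^-1` G k.
    by [].
  apply: measurableI.
    by rewrite -[X in measurable X]setTI; exact: measurable_tnth.
  by rewrite -[X in measurable X]setTI; exact: measurable_behead.
by rewrite lebesgue_tupleSE// lte_mul_pinfty// ge0_fin_numE.
Qed.

HB.instance Definition _ := Measure_isSigmaFinite.Build _ _ _ lebesgue_tupleS
  lebesgue_tupleS_sigma_finite.

End lebesgue_step.

(* R^n is n.-tuple R, whose sigma-algebra (generated by the coordinates) is the
   Borel one; Lebesgue measure is the iterated product of the one-dimensional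
   measures, cf. lebesgue_tuple_box. *)
Fixpoint lebesgue_tuple (R : realType) (n : nat) :
    {sigma_finite_measure set (n.-tuple R) -> \bar R} :=
  match n with
  | 0 => \d_ ([tuple] : 0.-tuple R)
  | k.+1 => lebesgue_tupleS (lebesgue_tuple R k)
  end.

Lemma lebesgue_tuple_box (R : realType) (n : nat) (A : 'I_n -> set R) :
  (forall i, measurable (A i)) ->
  lebesgue_tuple R n [set t | forall i, A i (tnth t i)] =
  (\prod_(i < n) lebesgue_measure (A i))%E.
Proof.
elim: n A => [|n ih] A mA.
  rewrite big_ord0 /= diracE mem_set//=.
  by case.
rewrite big_ord_recl -(ih (fun i => A (lift ord0 i)))// -lebesgue_tupleSE//.
  congr (lebesgue_tupleS _ _).
  apply/seteqP; split => t /= => [H|[H1 H2] i].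
    by split => // i; rewrite tnth_behead (_ : inord _ = lift ord0 i)//; apply/val_inj; rewrite /= inordK//= ltnS.
  have [->//|i0] := eqVneq i ord0.
  case: (unliftP ord0 i) i0 => [j ->|->]; last by rewrite eqxx.
  move=> _; have := H2 j; rewrite tnth_behead (_ : inord _ = lift ord0 j)//; apply/val_inj; rewrite /= inordK//= ltnS//.
have -> : [set t : n.-tuple R | forall i, A (lift ord0 i) (tnth t i)] =
  \bigcap_(i in [set: 'I_n]) ((fun t => tnth t i) @^-1` A (lift ord0 i)).
  by apply/seteqP; split => t /= => [H i _|H i]; exact: H.
apply: fin_bigcap_measurable => // i _.
by rewrite -[X in measurable X]setTI; exact: measurable_tnth.
Qed.

(* The measure r dmu. The positive part only makes the formula a measure for
   every r; it is harmless when r >= 0 mu-almost everywhere. *)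
Section weighted_measure.
Context d (T : measurableType d) (R : realType).
Variables (mu : {measure set T -> \bar R}) (r : {mfun T >-> measurableTypeR R}).

Definition weighted_measure (A : set T) : \bar R :=
  (\int[mu]_(x in A) ((r : T -> R)^\+ x)%:E)%E.

Let mr : measurable_fun [set: T] (EFin \o (r : T -> R)^\+).
Proof.
by apply/measurable_EFinP; apply: measurable_funrpos; exact: (measurable_funPT r).
Qed.

Let weighted_measure0 : weighted_measure set0 = 0%E.
Proof. exact: integral_set0. Qed.

Let weighted_measure_ge0 A : (0 <= weighted_measure A)%E.
Proof. by apply: integral_ge0 => x _; rewrite lee_fin funrpos_ge0. Qed.

Let weighted_measure_sigma_additive : semi_sigma_additive weighted_measure.
Proof.
move=> F mF tF mUF; rewrite /weighted_measure ge0_integral_bigcup//=; last 2 first.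
- exact: measurable_funTS.
- by move=> x _; rewrite lee_fin funrpos_ge0.
by apply: is_cvg_ereal_nneg_natsum_cond => n _ _; exact: weighted_measure_ge0.
Qed.

HB.instance Definition _ := isMeasure.Build _ _ _ weighted_measure
  weighted_measure0 weighted_measure_ge0 weighted_measure_sigma_additive.

End weighted_measure.

Section complex_L2.
Context d (T : measurableType d) (R : realType).
Variable mu : {measure set T -> \bar R}.

(* A complex function is measurable when its real and imaginary parts are. *)
Definition L2fun_pred : {pred T -> R[i]} := mem [set f : T -> R[i] |
  [/\ measurable_fun [set: T] (fun x => complex.Re (f x)),
      measurable_fun [set: T] (fun x => complex.Im (f x)) &
      finite_norm mu 2%:E (fun x => normc (f x))]].

Lemma measurable_normc (f : T -> R[i]) :
  measurable_fun [set: T] (fun x => complex.Re (f x)) ->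
  measurable_fun [set: T] (fun x => complex.Im (f x)) ->
  measurable_fun [set: T] (fun x => normc (f x)).
Proof.
move=> mRe mIm.
rewrite (_ : (fun x => normc (f x)) =
  (fun x => Num.sqrt (complex.Re (f x) ^+ 2 + complex.Im (f x) ^+ 2))); last first.
  by apply/funext => x; case: (f x).
apply: (measurableT_comp (continuous_measurable_fun (@sqrt_continuous R))).
by apply: measurable_funD; exact: measurable_funX.
Qed.

Lemma finite_norm_le (h k : T -> R) : measurable_fun [set: T] h ->
  measurable_fun [set: T] k -> (forall x, `|h x| <= `|k x|) ->
  finite_norm mu 2%:E k -> finite_norm mu 2%:E h.
Proof.
move=> mh mk hk; apply: le_lt_trans.
rewrite unlock /Lnorm gt0_ler_poweR//.
- by rewrite in_itv/= leey integral_ge0.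
- by rewrite in_itv/= leey integral_ge0.
apply: ge0_le_integral => //.
- by move=> x _; exact: poweR_ge0.
- apply: (measurableT_comp (measurable_poweR 2)).
  by apply: measurableT_comp => //; exact/measurable_EFinP.
- apply: (measurableT_comp (measurable_poweR 2)).
  by apply: measurableT_comp => //; exact/measurable_EFinP.
- by move=> x _; rewrite gt0_ler_poweR//= ?in_itv/= ?leey ?andbT ?lee_fin.
Qed.

Lemma L2fun_submod_closed : submod_closed L2fun_pred.
Proof.
split=> [|a f g].
  rewrite inE; split=> /=; [exact: measurable_cst|exact: measurable_cst|].
  rewrite (_ : (fun _ => _) = cst 0); last first.
    by apply/funext => x /=; rewrite expr0n/= addr0 sqrtr0.
  by apply: finite_norm_cst0; rewrite lee1n.
rewrite !inE => -[mRf mIf nf] [mRg mIg ng].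
have mR : measurable_fun [set: T] (fun x => complex.Re ((a *: f + g) x)).
  rewrite (_ : (fun x => _) = (fun x => complex.Re a * complex.Re (f x) - complex.Im a * complex.Im (f x) + complex.Re (g x))).
    apply: measurable_funD => //; apply: measurable_funB;
    apply: measurable_funM => //; exact: measurable_cst.
  apply/funext => x; rewrite /= !fctE.
  by move: a (f x) (g x) => [? ?] [? ?] [? ?].
have mI : measurable_fun [set: T] (fun x => complex.Im ((a *: f + g) x)).
  rewrite (_ : (fun x => _) = (fun x => complex.Re a * complex.Im (f x) + complex.Im a * complex.Re (f x) + complex.Im (g x))).
    apply: measurable_funD => //; apply: measurable_funD;
    apply: measurable_funM => //; exact: measurable_cst.
  apply/funext => x; rewrite /= !fctE.
  by clear mR; move: a (f x) (g x) => [? ?] [? ?] [? ?].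
split=> //.
have Lf : (fun x => normc (f x)) \in Lfun mu 2%:E.
  by rewrite inE/=; apply/andP; split; rewrite inE//=; exact: measurable_normc.
have Lg : (fun x => normc (g x)) \in Lfun mu 2%:E.
  by rewrite inE/=; apply/andP; split; rewrite inE//=; exact: measurable_normc.
have Laf : (normc a \o* (fun x => normc (f x))) \in Lfun mu 2%:E.
  by apply: Lfun_scale => //; rewrite ler1n.
have [_ /(_ _ _ Laf Lg)] := Lfun_addr_closed mu (lee1n 2 : (1 <= 2%:E)%E).
rewrite inE => /andP[]; rewrite !inE /= => m n.
apply: finite_norm_le n => //; first exact: measurable_normc.
move=> x; rewrite !fctE.
have normc_ge0 (z : R[i]) : 0 <= normc z by case: z => *; exact: sqrtr_ge0.
rewrite !ger0_norm ?addr_ge0 ?mulr_ge0//.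
have normcE (z : R[i]) : `|z| = (normc z)%:C%C by rewrite normc_def; case: z.
have := ler_normD (a * f x) (g x); rewrite normrM !normcE -rmorphM -rmorphD lecR.
by rewrite [X in _ <= X + _ -> _]mulrC.
Qed.

HB.instance Definition _ := GRing.isSubmodClosed.Build _ _ L2fun_pred L2fun_submod_closed.

Record L2fun := MkL2fun { L2fun_val :> T -> R[i]; _ : L2fun_val \in L2fun_pred }.
HB.instance Definition _ := [isSub for L2fun_val].
HB.instance Definition _ := [Choice of L2fun by <:].
HB.instance Definition _ := [SubChoice_isSubLmodule of L2fun by <:].

Definition L2null : {pred L2fun} :=
  mem [set f : L2fun | {ae mu, forall x, f x = 0}].

Lemma L2null_zmod_closed : zmod_closed L2null.
Proof.
split=> [|f g]; rewrite !inE /=; first exact: aeW.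
by apply: filterS2 => x fx gx; rewrite /= !fctE fx gx subrr.
Qed.
HB.instance Definition _ := GRing.isZmodClosed.Build _ L2null L2null_zmod_closed.

(* The genuine space L^2(mu): classes of functions modulo mu-null functions. *)
Definition L2 : Type := Quotient.quot L2null.
HB.instance Definition _ := ZmodQuotient.on L2.

Definition L2_class (f : L2fun) : L2 := (\pi_L2 f)%qT.
Definition L2_repr (u : L2) : T -> R[i] := L2fun_val (repr u).
Coercion L2_repr : L2 >-> Funclass.

Lemma L2_eqP (f g : L2fun) :
  L2_class f = L2_class g <-> {ae mu, forall x, f x = g x}.
Proof.
rewrite /L2_class; split.
  move=> /eqP; rewrite -Quotient.idealrBE inE /=.
  by apply: filterS => x /= /eqP; rewrite !fctE subr_eq0 => /eqP.
move=> fg; apply/eqP; rewrite -Quotient.idealrBE inE /=.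
by apply: filterS fg => x /= fgx; rewrite !fctE fgx subrr.
Qed.

Lemma L2_classK (u : L2) : L2_class (repr u) = u.
Proof. exact: reprK. Qed.

Definition L2_scale (a : R[i]) (u : L2) : L2 := L2_class (a *: repr u).

Lemma L2_scaleE a f : L2_scale a (L2_class f) = L2_class (a *: f).
Proof.
apply/L2_eqP.
have /L2_eqP := L2_classK (L2_class f).
by apply: filterS => x /= fx; rewrite !fctE fx.
Qed.

Lemma L2_classD f g : L2_class f + L2_class g = L2_class (f + g).
Proof. exact: (esym (Quotient.pi_add _ f g)). Qed.

Let scaleA a b u : L2_scale a (L2_scale b u) = L2_scale (a * b) u.
Proof. by rewrite -(L2_classK u) !L2_scaleE scalerA. Qed.
Let scale1 : left_id 1 L2_scale.
Proof. by move=> u; rewrite -(L2_classK u) L2_scaleE scale1r. Qed.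
Let scaleDr : right_distributive L2_scale +%R.
Proof.
move=> a u v; rewrite -(L2_classK u) -(L2_classK v).
by rewrite !(L2_scaleE, L2_classD) scalerDr.
Qed.
Let scaleDl u : {morph L2_scale^~ u : a b / a + b}.
Proof. by move=> a b; rewrite -(L2_classK u) !L2_scaleE L2_classD scalerDl. Qed.

HB.instance Definition _ := GRing.Zmodule_isLmodule.Build R[i] L2
  scaleA scale1 scaleDr scaleDl.

Definition L2norm (u : L2) : R :=
  fine ('N[mu]_2%:E[EFin \o (fun x => normc (u x))])%E.

Lemma L2norm_class (f : L2fun) :
  L2norm (L2_class f) = fine ('N[mu]_2%:E[EFin \o (fun x => normc (f x))])%E.
Proof.
have mnormc (g : L2fun) : measurable_fun [set: T] (fun x => (`|(normc (g x))%:E| `^ 2)%E).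
  apply: (measurableT_comp (measurable_poweR 2)); apply: measurableT_comp => //.
  apply/measurable_EFinP/measurable_normc.
    by have := valP g; rewrite inE => -[].
  by have := valP g; rewrite inE => -[].
rewrite /L2norm unlock /Lnorm; congr (fine (_ `^ _)%E).
apply: ge0_ae_eq_integral => //.
- exact: mnormc.
- exact: mnormc.
- by move=> x _; exact: poweR_ge0.
- by move=> x _; exact: poweR_ge0.
have /L2_eqP := L2_classK (L2_class f).
by apply: filterS => x /= + _; rewrite /L2_repr => ->.
Qed.

End complex_L2.

Section weighted_integral.
Context d (T : measurableType d) (R : realType).
Variables (mu : {measure set T -> \bar R}) (r : {mfun T >-> measurableTypeR R}).
Import HBNNSimple.
Local Open Scope ereal_scope.
Let w : T -> \bar R := EFin \o (r : T -> R)^\+%R.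

Let w0 x : 0 <= w x. Proof. by rewrite lee_fin funrpos_ge0. Qed.

Let mw : measurable_fun [set: T] w.
Proof.
by apply/measurable_EFinP; apply: measurable_funrpos; exact: (measurable_funPT r).
Qed.

Lemma ge0_integral_weighted (f : T -> \bar R) :
  measurable_fun [set: T] f -> (forall x, 0 <= f x) ->
  \int[weighted_measure mu r]_x f x = \int[mu]_x (f x * w x).
Proof.
move=> mf f0.
pose f_ := nnsfun_approx measurableT mf.
transitivity (limn (fun n => \int[weighted_measure mu r]_x (f_ n x)%:E)).
  rewrite -monotone_convergence//.
  - apply: eq_integral => y _; apply/esym/cvg_lim => //.
    by apply: cvg_nnsfun_approx => // *; exact: f0.
  - by move=> n; exact/measurable_EFinP/measurable_funP.
  - by move=> n y _; rewrite lee_fin.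
  - by move=> y _ m n mn; rewrite lee_fin; exact/lefP/nd_nnsfun_approx.
rewrite [X in limn X](_ : _ = (fun n => \int[mu]_x ((f_ n x)%:E * w x))).
  rewrite -monotone_convergence//.
  - apply: eq_integral => x _ /=; apply/cvg_lim => //.
    by apply: cvgeZr; [|exact: cvg_nnsfun_approx].
  - by move=> n; apply: emeasurable_funM => //; exact/measurable_EFinP.
  - by move=> n x _; rewrite mule_ge0// lee_fin.
  - move=> x _ m n mn; rewrite lee_wpmul2r// lee_fin.
    exact/lefP/nd_nnsfun_approx.
apply/funext => n.
under [LHS]eq_integral do rewrite fimfunE -fsumEFin//.
rewrite ge0_integral_fsum//; last 2 first.
  - by move=> y; exact/measurable_EFinP/measurable_funM.
  - by move=> y x _; rewrite nnfun_muleindic_ge0.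
transitivity (\sum_(k \in range (f_ n))
    \int[mu]_x ((k * \1_(f_ n @^-1` [set k]) x)%:E * w x)).
  apply: eq_fsbigr => k; rewrite inE => -[t _ <-].
  under [RHS]eq_integral do rewrite EFinM -muleA.
  rewrite ge0_integralZl//; last 3 first.
    - by apply: emeasurable_funM => //; exact/measurable_EFinP.
    - by move=> x _; rewrite mule_ge0// lee_fin.
    - by rewrite lee_fin.
  rewrite integralZl_indic_nnsfun// integral_indic//= setIT.
  congr (_ * _); rewrite /weighted_measure [LHS]integral_mkcond.
  apply: eq_integral => x _; rewrite patchE indicE.
  by case: ifPn; rewrite ?mul1e ?mul0e.
rewrite -ge0_integral_fsum//.
- apply: eq_integral => x _; rewrite -ge0_mule_fsuml// ?fsumEFin// -?fimfunE//.
  by move=> k; rewrite nnfun_muleindic_ge0.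
- move=> k; apply: emeasurable_funM => //.
  exact/measurable_EFinP/measurable_funM.
- by move=> k x _; rewrite mule_ge0// nnfun_muleindic_ge0.
Qed.

End weighted_integral.

Section sqrt_transform.
Context d (T : measurableType d) (R : realType).
Variables (mu : {measure set T -> \bar R}) (r : {mfun T >-> measurableTypeR R}).
Local Notation nu := (weighted_measure mu r).

(* Num.sqrt is 0 on negative numbers. *)
Definition sqrt_mul (f : T -> R[i]) (x : T) : R[i] :=
  (Num.sqrt (r x : R))%:C%C * f x.

Let Re_sqrt_mul f x :
  complex.Re (sqrt_mul f x) = Num.sqrt (r x : R) * complex.Re (f x).
Proof. by rewrite /sqrt_mul; case: (f x) => a b /=; rewrite mul0r subr0. Qed.

Let Im_sqrt_mul f x :
  complex.Im (sqrt_mul f x) = Num.sqrt (r x : R) * complex.Im (f x).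
Proof. by rewrite /sqrt_mul; case: (f x) => a b /=; rewrite mul0r addr0. Qed.

Let msqrt : measurable_fun [set: T] (fun x => Num.sqrt (r x : R)).
Proof.
apply: (measurableT_comp (continuous_measurable_fun (@sqrt_continuous R))).
exact: (measurable_funPT r).
Qed.

Lemma Lnorm_sqrt_mul (f : T -> R[i]) :
  measurable_fun [set: T] (fun x => complex.Re (f x)) ->
  measurable_fun [set: T] (fun x => complex.Im (f x)) ->
  ('N[mu]_2%:E[EFin \o (fun x => normc (sqrt_mul f x))] =
   'N[nu]_2%:E[EFin \o (fun x => normc (f x))])%E.
Proof.
move=> mRe mIm; rewrite unlock /Lnorm; congr (_ `^ _)%E.
rewrite ge0_integral_weighted//.
- apply: eq_integral => x _ /=; rewrite /sqrt_mul normcM.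
  have -> : normc (Num.sqrt (r x : R))%:C%C = Num.sqrt (r x : R).
    by rewrite /= expr0n addr0 sqrtr_sqr ger0_norm// sqrtr_ge0.
  rewrite normrM powRM ?normr_ge0// EFinM muleC; congr (_ * _%:E)%E.
  rewrite powR_mulrn// ger0_norm ?sqrtr_ge0// /funrpos.
  have [r0|r0] := leP 0 (r x : R).
    by rewrite sqr_sqrtr//.
  by rewrite ltr0_sqrtr// expr0n.
- apply: (measurableT_comp (measurable_poweR 2)).
  apply: measurableT_comp => //; apply/measurable_EFinP.
  exact: measurable_normc.
- by move=> x; exact: poweR_ge0.
Qed.

Lemma sqrt_mul_L2fun (f : T -> R[i]) :
  f \in L2fun_pred nu -> sqrt_mul f \in L2fun_pred mu.
Proof.
rewrite !inE => -[mRe mIm nf]; split.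
- under eq_fun do rewrite Re_sqrt_mul.
  exact: measurable_funM.
- under eq_fun do rewrite Im_sqrt_mul.
  exact: measurable_funM.
- by rewrite /finite_norm Lnorm_sqrt_mul.
Qed.

Definition L2fun_sqrt_mul (f : L2fun nu) : L2fun mu :=
  MkL2fun (sqrt_mul_L2fun (valP f)).

Definition sqrt_transform (f : L2 nu) : L2 mu :=
  L2_class (L2fun_sqrt_mul (repr f)).

Let mrp : measurable_fun [set: T] (EFin \o (r : T -> R)^\+).
Proof.
by apply/measurable_EFinP; apply: measurable_funrpos; exact: (measurable_funPT r).
Qed.

Lemma ae_weightedP (P : set T) :
  {ae nu, forall x, P x} <-> {ae mu, forall x, 0 < (r x : R) -> P x}.
Proof.
pose w : T -> \bar R := EFin \o (r : T -> R)^\+.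
have rpE x : (`|w x| = w x)%E.
  by rewrite gee0_abs// lee_fin funrpos_ge0.
split=> -[A [mA A0 PA]].
  have /ae_eq_integral_abs : measurable_fun A w.
    exact: measurable_funTS.
  move=> /(_ mu mA)[+ _]; rewrite -/w.
  under eq_integral do rewrite rpE.
  move=> /(_ A0); apply: filterS => x /= rA r0; apply: contrapT => nPx.
  have /rA[] : A x by exact: PA.
  by rewrite /funrpos max_l ?ltW// => r00; rewrite r00 ltxx in r0.
have mr0 : measurable [set x | (r x : R) <= 0].
  rewrite (_ : [set x | _] = r @^-1` `]-oo, 0]); last first.
    by apply/seteqP; split => x /=; rewrite in_itv.
  by rewrite -[X in measurable X]setTI; exact: (measurable_funPT r).
exists (A `|` [set x | (r x : R) <= 0]); split.
- exact: measurableU.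
- rewrite /= /weighted_measure.
  under eq_integral do rewrite -[(_%:E)%E]/(w _) -rpE.
  apply/ae_eq_integral_abs; first exact: measurableU.
    exact: measurable_funTS.
  exists A; split => // x /= /not_implyP[] [//|r0].
  by rewrite /w /= /funrpos max_r.
- move=> x /= nPx; have [r0|r0] := leP (r x : R) 0; first by right.
  by left; apply: PA => /= /(_ r0).
Qed.

Lemma sqrt_transformE (f : L2fun nu) :
  sqrt_transform (L2_class f) = L2_class (L2fun_sqrt_mul f).
Proof.
apply/L2_eqP; have /L2_eqP/ae_weightedP := L2_classK (L2_class f).
apply: filterS => x /= rfE; rewrite /sqrt_mul.
have [/rfE ->//|r0] := ltP 0 (r x : R).
by rewrite ler0_sqrtr// !mul0r.
Qed.

Lemma L2norm_sqrt_transform u : L2norm (sqrt_transform u) = L2norm u.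
Proof.
rewrite -(L2_classK u) sqrt_transformE !L2norm_class Lnorm_sqrt_mul//.
all: by have := valP (repr u); rewrite inE => -[].
Qed.

Lemma sqrt_transform_linear : linear sqrt_transform.
Proof.
move=> a u v; rewrite -(L2_classK u) -(L2_classK v).
rewrite -[a *: L2_class (repr u)]/(L2_scale a _) L2_scaleE L2_classD.
rewrite !sqrt_transformE -[a *: L2_class _]/(L2_scale a _) L2_scaleE L2_classD.
congr L2_class; apply/val_inj/funext => x /=.
by rewrite /sqrt_mul !fctE /= mulrDr mulrCA.
Qed.

Let isq (x : T) : R := ((r : T -> R)^\+ x) `^ (- 2^-1).

Let sqrt_isq x : Num.sqrt (r x : R) * isq x = if 0 < (r x : R) then 1 else 0.
Proof.
rewrite /isq /funrpos; have [r0|r0] := ltP 0 (r x : R).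
  rewrite powRN -powR12_sqrt ?ltW// mulfV//.
  by rewrite gt_eqF// powR_gt0.
by rewrite ler0_sqrtr// mul0r.
Qed.

Lemma sqrt_transform_bij : {ae mu, forall x, 0 <= (r x : R)} ->
  set_bij [set: L2 nu] [set u : L2 mu | {ae mu, forall x, (r x : R) = 0 -> u x = 0}]
    sqrt_transform.
Proof.
move=> r_ge0; split.
- move=> u _ /=; rewrite -(L2_classK u) sqrt_transformE.
  have /L2_eqP := L2_classK (L2_class (L2fun_sqrt_mul (repr u))).
  by apply: filterS => x /= + r0; rewrite /L2_repr => ->; rewrite /= /sqrt_mul r0 sqrtr0 mul0r.
- move=> u v _ _; rewrite -(L2_classK u) -(L2_classK v) !sqrt_transformE.
  move=> /L2_eqP uv; apply/L2_eqP/ae_weightedP.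
  apply: filterS uv => x /= + r0; rewrite /sqrt_mul => /mulfI; apply.
  by rewrite eq_complex/= eqxx andbT sqrtr_eq0 -ltNge.
- move=> u /= Vu.
  pose g x : R[i] := (isq x)%:C%C * u x.
  have gE x : sqrt_mul g x = if 0 < (r x : R) then u x else 0.
    rewrite /sqrt_mul /g mulrA -rmorphM sqrt_isq.
    by case: ifP; rewrite ?mul1r ?mul0r.
  have := valP (repr u); rewrite inE -/(L2_repr u) => -[mRe mIm nu_].
  have misq : measurable_fun [set: T] isq.
    apply: (measurableT_comp (measurable_powR (- 2^-1))).
    by apply: measurable_funrpos; exact: (measurable_funPT r).
  have mReg : measurable_fun [set: T] (fun x => complex.Re (g x)).
    rewrite (_ : (fun x => _) = isq \* (fun x => complex.Re (u x))).
      exact: measurable_funM.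
    by apply/funext => x; rewrite /g /=; case: (u x) => a b /=; rewrite mul0r subr0.
  have mImg : measurable_fun [set: T] (fun x => complex.Im (g x)).
    rewrite (_ : (fun x => _) = isq \* (fun x => complex.Im (u x))).
      exact: measurable_funM.
    by apply/funext => x; rewrite /g /=; case: (u x) => a b /=; rewrite mul0r addr0.
  have Lg : g \in L2fun_pred nu.
    rewrite inE; split => //; rewrite /finite_norm -Lnorm_sqrt_mul//.
    apply: finite_norm_le nu_.
    + apply: measurable_normc.
        under eq_fun do rewrite Re_sqrt_mul.
        exact: measurable_funM.
      under eq_fun do rewrite Im_sqrt_mul.
      exact: measurable_funM.
    + exact: measurable_normc.
    + by move=> x; rewrite gE; case: ifP => // _; rewrite normc0 normr0.
  exists (L2_class (MkL2fun Lg)) => //.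
  rewrite sqrt_transformE -[RHS]L2_classK; apply/L2_eqP.
  apply: filterS2 r_ge0 Vu => x /= r0 Vx; rewrite gE.
  move: r0 Vx; rewrite le_eqVlt => /predU1P[r0 /(_ (esym r0))|-> //].
  by rewrite -r0 ltxx.
Qed.

End sqrt_transform.

Record bounded_operator d (T : measurableType d) (R : realType)
    (mu : {measure set T -> \bar R}) := BoundedOperator {
  bounded_operator_fun :> {linear L2 mu -> L2 mu};
  bounded_operatorP : exists C : R,
    forall u, L2norm (bounded_operator_fun u) <= C * L2norm u }.

Lemma identity_bounded d (T : measurableType d) (R : realType)
    (mu : {measure set T -> \bar R}) :
  exists C : R, forall u : L2 mu, L2norm (idfun u) <= C * L2norm u.
Proof. by exists 1 => u; rewrite mul1r. Qed.

Definition identity_operator d (T : measurableType d) (R : realType)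
    (mu : {measure set T -> \bar R}) : bounded_operator mu :=
  BoundedOperator (identity_bounded mu).

Section extension_policies.
Context d (T : measurableType d) (R : realType).
Variable lam : {measure set T -> \bar R}.

(* Densities are classes in L^1(lam), not functions; the measure lam is kept
   abstract here, the intended one being lebesgue_tuple R n. *)
Record density := Density {
  density_class :> LspaceType lam (@lexx _ _ 1%E);
  density_ge0 : {ae lam, forall x, 0 <= (density_class x : R)};
  density_int : (\int[lam]_x (density_class x : R)%:E = 1)%E }.

Definition density_mfun (rho : density) : {mfun T >-> measurableTypeR R} :=
  repr (rho : {mfun_ lam, T >-> measurableTypeR R}).

Definition density_measure (rho : density) : {measure set T -> \bar R} :=
  weighted_measure lam (density_mfun rho).

Definition zero_set (rho : density) : set T := [set x | (rho x : R) = 0].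

Definition Vspace (rho : density) : set (L2 lam) :=
  [set u | {ae lam, forall x, zero_set rho x -> u x = 0}].

Definition Umap (rho : density) : L2 (density_measure rho) -> L2 lam :=
  sqrt_transform (r := density_mfun rho).

Lemma Umap_linear rho : linear (@Umap rho).
Proof. exact: sqrt_transform_linear. Qed.

Lemma L2norm_Umap rho u : L2norm (@Umap rho u) = L2norm u.
Proof. exact: L2norm_sqrt_transform. Qed.

Lemma Umap_bij rho :
  set_bij [set: L2 (density_measure rho)] (Vspace rho) (@Umap rho).
Proof. exact: sqrt_transform_bij (density_ge0 rho). Qed.

Definition intrinsic_family :=
  forall rho : density, bounded_operator (density_measure rho).

Definition identity_family : intrinsic_family :=
  fun rho => identity_operator (density_measure rho).

(* U_rho^-1 is the inverse of the bijection of Umap_bij; only the values on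
   Vspace rho are meaningful. *)
Definition sharp (rho : density) (A : bounded_operator (density_measure rho))
    (u : L2 lam) : L2 lam :=
  Umap (A ('pinv_(fun=> 0) [set: L2 (density_measure rho)] (@Umap rho) u)).

Record extension_policy (A : intrinsic_family) := ExtensionPolicy {
  policy_operator :> density -> bounded_operator lam;
  policy_restrict : forall rho, {in Vspace rho, policy_operator rho =1 sharp (A rho)} }.

Definition L1dist (rho sigma : density) : R :=
  fine ('N[lam]_1[EFin \o (fun x => (rho x : R) - (sigma x : R))%R])%E.

Definition d_oplus (p q : L2 lam * density) : R :=
  L2norm (p.1 - q.1) + L1dist p.2 q.2.

Section induced.
Variables (A : intrinsic_family) (P : extension_policy A).

Definition policy_map (p : L2 lam * density) : L2 lam * density :=
  (P p.2 p.1, p.2).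

Definition globally_lipschitz := exists2 L : R, 0 <= L &
  forall p q, d_oplus (policy_map p) (policy_map q) <= L * d_oplus p q.

Definition policy_continuous_at (p : L2 lam * density) :=
  forall e : R, 0 < e -> exists2 del : R, 0 < del &
    forall q, d_oplus p q < del -> d_oplus (policy_map p) (policy_map q) < e.

Definition discontinuous_at_density (rho : density) :=
  exists u, ~ policy_continuous_at (u, rho).
End induced.
End extension_policies.

Arguments identity_family {d T R} lam.

(* Main.v *)
Require Import Defs.
From HB Require Import structures.
From mathcomp Require Import all_boot all_order all_algebra.
From mathcomp Require Import complex ring lra.
From mathcomp Require Import all_classical all_reals all_analysis.
From mathcomp Require Import measurable_realfun.

(* Extending by the identity of L^2 is trivially Lipschitz.  Extending by the
   orthogonal projection u |-> 1_{rho <> 0} u onto V_rho is discontinuous as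
   soon as {rho = 0} has positive measure: pick B inside {rho = 0} with
   0 < lam B < +oo and put u = 1_B.  The densities
   (1 - t) rho + t 1_B / lam B tend to rho as t -> 0 and do not vanish on B,
   so their extensions fix u, whereas the one at rho sends u to 0. *)

Set Implicit Arguments.
Unset Strict Implicit.
Unset Printing Implicit Defensive.

Import Order.TTheory GRing.Theory Num.Theory.
Import numFieldNormedType.Exports.
Import Normc.

Local Open Scope classical_set_scope.
Local Open Scope ring_scope.

(** * Definiteness of the L^2 norm, and restriction to a measurable set as a bounded operator *)

Section L2_complements.
Context d (T : measurableType d) (R : realType).
Variable mu : {measure set T -> \bar R}.
Implicit Types (A : set T) (u : L2 mu).

Lemma L2fun_measurable_normc (f : L2fun mu) :
  measurable_fun [set: T] (fun x => normc (f x)).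
Proof.
by have := valP f; rewrite inE => -[? ? _]; exact: measurable_normc.
Qed.

Lemma L2_class0 : L2_class (0 : L2fun mu) = 0.
Proof. by apply: (addrI (L2_class 0)); rewrite L2_classD !addr0. Qed.

Lemma L2norm_ge0 u : 0 <= L2norm u.
Proof. by rewrite fine_ge0// Lnorm_ge0. Qed.

Lemma L2norm0 : L2norm (0 : L2 mu) = 0.
Proof.
rewrite -L2_class0 L2norm_class.
rewrite (_ : _ \o _ = cst 0%E) ?Lnorm0//.
by apply/funext => x /=; rewrite expr0n/= addr0 sqrtr0.
Qed.

Lemma L2norm_eq0 u : L2norm u = 0 -> u = 0.
Proof.
rewrite -(L2_classK u) L2norm_class => /eqP.
(* [fine] also sends infinite values to 0, so the norm must first be seen to be finite. *)
set f := repr u; rewrite fine_eq0; last first.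
  rewrite ge0_fin_numE ?Lnorm_ge0//.
  by have := valP f; rewrite inE => -[].
move=> /eqP /Lnorm_eq0_eq0 f0.
rewrite -L2_class0; apply/L2_eqP.
apply: filterS (f0 _ _) => [x /= /(_ I) [] /eq0_normc //||].
  exact/measurable_EFinP/L2fun_measurable_normc.
by rewrite lte_fin.
Qed.

Definition restrict0 A (f : T -> R[i]) : T -> R[i] :=
  fun x => if x \in A then f x else 0.

Lemma Re_restrict0 A f :
  (fun x => complex.Re (restrict0 A f x)) = (@complex.Re R \o f) \_ A.
Proof. by apply/funext => x; rewrite /restrict0 patchE; case: ifP. Qed.

Lemma Im_restrict0 A f :
  (fun x => complex.Im (restrict0 A f x)) = (@complex.Im R \o f) \_ A.
Proof. by apply/funext => x; rewrite /restrict0 patchE; case: ifP. Qed.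

Lemma normc_restrict0_le A f x : `|normc (restrict0 A f x)| <= `|normc (f x)|.
Proof. by rewrite /restrict0; case: ifP => // _; rewrite normc0 normr0. Qed.

Lemma restrict0_L2fun A (f : L2fun mu) : measurable A ->
  restrict0 A f \in L2fun_pred mu.
Proof.
move=> mA; have := valP f; rewrite !inE => -[mRe mIm nf].
have mRe' : measurable_fun [set: T] (fun x => complex.Re (restrict0 A f x)).
  rewrite Re_restrict0; apply/(measurable_restrictT _ _).1 => //.
  exact: measurable_funTS.
have mIm' : measurable_fun [set: T] (fun x => complex.Im (restrict0 A f x)).
  rewrite Im_restrict0; apply/(measurable_restrictT _ _).1 => //.
  exact: measurable_funTS.
split => //; apply: finite_norm_le nf; [exact: measurable_normc..|].
exact: normc_restrict0_le.
Qed.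

Section restriction_operator.
Variables (A : set T) (mA : measurable A).

Definition L2fun_restrict (f : L2fun mu) : L2fun mu :=
  MkL2fun (restrict0_L2fun f mA).

Definition L2_restrict u : L2 mu := L2_class (L2fun_restrict (repr u)).

(** Restriction preserves almost everywhere equality, so the choice of [repr u] does not matter and
    later identities can be checked on functions. *)
Lemma L2_restrictE f : L2_restrict (L2_class f) = L2_class (L2fun_restrict f).
Proof.
apply/L2_eqP; have /L2_eqP := L2_classK (L2_class f).
by apply: filterS => x /=; rewrite /restrict0; case: ifP.
Qed.

Lemma L2_restrict_linear : linear L2_restrict.
Proof.
move=> a u v; rewrite -(L2_classK u) -(L2_classK v).
rewrite -[a *: L2_class (repr u)]/(L2_scale a _) L2_scaleE L2_classD.
rewrite !L2_restrictE -[a *: L2_class _]/(L2_scale a _) L2_scaleE L2_classD.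
congr L2_class; apply/val_inj/funext => x /=.
rewrite !fctE /= /restrict0.
by case: ifP; rewrite //= scaler0 addr0.
Qed.

HB.instance Definition _ :=
  GRing.isLinear.Build R[i] (L2 mu) (L2 mu) _ L2_restrict L2_restrict_linear.

Lemma L2norm_restrict_le u : L2norm (L2_restrict u) <= L2norm u.
Proof.
rewrite -(L2_classK u) L2_restrictE !L2norm_class.
(* [fine] is monotone only between finite values. *)
have fin (g : L2fun mu) :
    'N[mu]_2%:E[EFin \o (fun x => normc (g x))]%E \is a fin_num.
  by rewrite ge0_fin_numE ?Lnorm_ge0//; have := valP g; rewrite inE => -[].
rewrite fine_le// unlock /Lnorm gt0_ler_poweR//.
- by rewrite in_itv/= leey integral_ge0// => x _; exact: poweR_ge0.
- by rewrite in_itv/= leey integral_ge0// => x _; exact: poweR_ge0.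
have mN (g : L2fun mu) : measurable_fun [set: T] (fun x => (`|(normc (g x))%:E| `^ 2)%E).
  apply: (measurableT_comp (measurable_poweR 2)); apply: measurableT_comp => //.
  exact/measurable_EFinP/L2fun_measurable_normc.
apply: ge0_le_integral => //.
- by move=> x _; exact: poweR_ge0.
- exact: mN.
- exact: mN.
- move=> x _; rewrite gt0_ler_poweR//= ?in_itv/= ?leey ?andbT ?lee_fin//.
  exact: normc_restrict0_le.
Qed.

Lemma L2_restrict_bounded : exists C : R,
  forall u, L2norm (L2_restrict u) <= C * L2norm u.
Proof. by exists 1 => u; rewrite mul1r L2norm_restrict_le. Qed.

Definition restrict_operator : bounded_operator mu :=
  BoundedOperator L2_restrict_bounded.

End restriction_operator.
End L2_complements.

(** * Densities as L^1 classes, the two extension policies, and perturbation of a density *)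

Section densities.
Context d (T : measurableType d) (R : realType).
Variable lam : {measure set T -> \bar R}.
Implicit Types rho : density lam.

Lemma density_measurable rho : measurable_fun [set: T] (rho : T -> R).
Proof. exact: (measurable_funPT (density_mfun rho)). Qed.

Lemma zero_set_measurable rho : measurable (zero_set rho).
Proof.
rewrite -[zero_set rho]setTI.
exact: (density_measurable rho measurableT (measurable_set1 (0 : R))).
Qed.

Lemma density_integrable rho : lam.-integrable [set: T] (EFin \o (rho : T -> R)).
Proof.
apply/Lfun1_integrable/andP; split; rewrite inE /=.
  exact: density_measurable.
exact: Lebesgue_finite.
Qed.

(** A density is a class whose values are those of a chosen representative, so a concrete [g] is
    recovered only almost everywhere. Finiteness of the norm, the sign and the integral all transfer
    along that equality. *)
Lemma density_of_integrable (g : T -> R) :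
  lam.-integrable [set: T] (EFin \o g) -> {ae lam, forall x, 0 <= g x} ->
  (\int[lam]_x (g x)%:E = 1)%E ->
  exists rho, {ae lam, forall x, (rho x : R) = g x}.
Proof.
move=> ig g0 g1.
have mg : measurable_fun [set: T] (g : T -> measurableTypeR R).
  by have /measurable_int/measurable_EFinP := ig.
pose gm : {mfun T >-> measurableTypeR R} :=
  HB.pack (g : T -> measurableTypeR R)
    (isMeasurableFun.Build d _ T (measurableTypeR R) g mg).
pose q : {mfun_ lam, T >-> measurableTypeR R} := (\pi gm)%qT.
have qg : {ae lam, forall x, (q x : R) = g x}.
  have /asboolP : ae_eq_op lam (repr q) gm by rewrite -eqmodE reprK.
  by apply: filterS => x /= /(_ I).
have mq : measurable_fun [set: T] (EFin \o (q : T -> R)).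
  exact/measurable_EFinP/(measurable_funPT (repr q)).
have nq : finite_norm lam 1 (q : T -> R).
  rewrite /finite_norm Lnorm1.
  rewrite (ae_eq_integral (fun x => `|(g x)%:E|)%E)//.
  - by have /integrableP[] := ig.
  - exact: measurableT_comp.
  - by apply: measurableT_comp => //; exact/measurable_EFinP.
  - by apply: filterS qg => x /= -> _.
pose L : LspaceType lam (@lexx _ _ 1%E) := HB.pack q
  (isFinLebesgue.Build d T R lam _ (@lexx _ _ 1%E) q nq).
have L0 : {ae lam, forall x, 0 <= (L x : R)}.
  by apply: filterS2 qg g0 => x /= ->.
have L1 : (\int[lam]_x (L x : R)%:E = 1)%E.
  rewrite -[RHS]g1; apply: ae_eq_integral => //; first exact/measurable_EFinP.
  by apply: filterS qg => x /= -> _.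
by exists (Density L0 L1).
Qed.

(** [Umap] maps onto [Vspace rho], so its [pinv] is a right inverse there. *)
Lemma sharp_identity rho :
  {in Vspace rho, sharp (identity_family lam rho) =1 id}.
Proof.
by move=> u Vu; have [_ _ Usurj] := Umap_bij rho; exact: (surjpK _ Usurj Vu).
Qed.

Lemma L1dist_ge0 rho sigma : 0 <= L1dist rho sigma.
Proof. by rewrite fine_ge0// Lnorm_ge0. Qed.

Definition identity_policy : extension_policy (identity_family lam).
Proof.
exists (fun=> identity_operator lam) => rho u Vu.
by rewrite sharp_identity.
(* Kept transparent: the Lipschitz bound below holds because [policy_map] computes to the
   identity. *)
Defined.

Lemma identity_policy_lipschitz : globally_lipschitz identity_policy.
Proof. by exists 1 => // p q; rewrite mul1r. Qed.

(** An element of [Vspace rho] already vanishes almost everywhere on the zero set, so cutting it off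
    there leaves its class unchanged. *)
Lemma restrict_policy_subproof rho :
  {in Vspace rho, restrict_operator lam (measurableC (zero_set_measurable rho))
    =1 sharp (identity_family lam rho)}.
Proof.
move=> u Vu; rewrite sharp_identity//=.
rewrite -[RHS]L2_classK; apply/L2_eqP.
move: Vu; rewrite inE; apply: filterS => x /= u0; rewrite /restrict0.
by case: ifPn => //; rewrite notin_setE /= => /contrapT /u0 <-.
Qed.

Definition restrict_policy : extension_policy (identity_family lam) :=
  ExtensionPolicy restrict_policy_subproof.

(** Mix [rho] with the uniform density [h] on [B], with weight [t] on [h]. On [B], where [rho]
    vanishes, the mixture equals [t / lam B], and its distance to [rho] is at most [2 * t]. *)
Lemma density_perturbation (rho : density lam) (B : set T) (e : R) :
  measurable B -> (0 < lam B)%E -> (lam B < +oo)%E -> B `<=` zero_set rho ->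
  0 < e ->
  exists sigma : density lam, L1dist rho sigma < e /\
    {ae lam, forall x, B x -> (sigma x : R) != 0}.
Proof.
move=> mB B0 Boo Bz e0.
pose b := fine (lam B).
have bE : lam B = b%:E by rewrite fineK// ge0_fin_numE.
have b0 : 0 < b by rewrite -lte_fin -bE.
pose h (x : T) : R := b^-1 * \1_B x.
have h0 x : 0 <= h x by rewrite mulr_ge0// invr_ge0 ltW.
have mh : measurable_fun [set: T] h.
  by apply: measurable_funM => //; exact: measurable_indic.
have h1 : (\int[lam]_x (h x)%:E = 1)%E.
  under eq_integral do rewrite EFinM.
  rewrite ge0_integralZl//; first last.
  - by rewrite lee_fin invr_ge0 ltW.
  - by apply/measurable_EFinP; exact: measurable_indic.
  by rewrite integral_indic// setIT bE -EFinM mulVf// gt_eqF.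
have ih : lam.-integrable [set: T] (EFin \o h).
  apply/integrableP; split; first exact/measurable_EFinP.
  under eq_integral do rewrite /= ger0_norm//.
  by rewrite h1 ltry.
(* The bound [2^-1] keeps both weights positive, and [e / 3] gives [2 * t <= 2 * e / 3 < e]. *)
pose t := Num.min 2^-1 (e / 3).
have t0 : 0 < t by rewrite lt_min; apply/andP; split; lra.
have t1 : t < 1 by rewrite gt_min; apply/orP; left; lra.
have te : 2 * t < e.
  have := ge_min (e / 3) 2^-1 (e / 3); rewrite lexx orbT -/t => te3.
  lra.
have ir := density_integrable rho.
pose g x : R := (1 - t) * rho x + t * h x.
have gE : EFin \o g = ((fun x => (1 - t)%:E * (rho x : R)%:E) \+
                        (fun x => t%:E * (h x)%:E))%E.
  by apply/funext => x; rewrite /= EFinD !EFinM.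
have ig : lam.-integrable [set: T] (EFin \o g).
  by rewrite gE; apply: integrableD => //; exact: integrableZl.
have g1 : (\int[lam]_x (g x)%:E = 1)%E.
  rewrite -[LHS]/(\int[lam]_x ((EFin \o g) x))%E gE integralD//; [|exact: integrableZl..].
  by rewrite !integralZl// h1 density_int !mule1 -EFinD subrK.
have g0 : {ae lam, forall x, 0 <= g x}.
  apply: filterS (density_ge0 rho) => x /= r0.
  by rewrite addr_ge0// mulr_ge0//; lra.
have [sigma sg] := density_of_integrable ig g0 g1.
exists sigma; split; last first.
  apply: filterS sg => x /= -> Bx.
  rewrite /g (Bz _ Bx) mulr0 add0r /h indicE mem_set// mulr1.
  by rewrite mulf_neq0// ?gt_eqF// invr_gt0.
apply: le_lt_trans te.
rewrite -lee_fin /L1dist Lnorm1 fineK; last first.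
  rewrite ge0_fin_numE ?integral_ge0//.
  have /integrableP[_] : lam.-integrable [set: T]
      (EFin \o (fun x => (rho x : R) - (sigma x : R))).
    rewrite /comp; under eq_fun do rewrite EFinB.
    by apply: integrableB => //; exact: density_integrable.
  by [].
have nr1 : (\int[lam]_x `|rho x : R|%:E = 1)%E.
  rewrite -[RHS](density_int rho); apply: ae_eq_integral => //.
  - apply/measurable_EFinP; apply: measurableT_comp => //;
    exact: density_measurable.
  - exact/measurable_EFinP/density_measurable.
  - by apply: filterS (density_ge0 rho) => x /= r0 _; rewrite ger0_norm.
have inr : lam.-integrable [set: T] (EFin \o (fun x => `|rho x : R|)).
  exact: (integrable_abse ir).
(* Almost everywhere [rho - sigma = t * (rho - h)]; the triangle inequality gives this integrand, of
   total mass [2 * t]. *)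
apply: (@le_trans _ _ (\int[lam]_x (t%:E * `|rho x : R|%:E + t%:E * (h x)%:E))%E); last first.
  rewrite integralD//; [|exact: integrableZl..].
  by rewrite !integralZl// h1 nr1 !mule1 -EFinD lee_fin; lra.
apply: ae_ge0_le_integral => //.
- apply: measurableT_comp => //; apply/measurable_EFinP.
  by apply: measurable_funB; exact: density_measurable.
- by move=> x _; rewrite -!EFinM -EFinD lee_fin addr_ge0// mulr_ge0// ltW.
- apply: emeasurable_funD; apply: emeasurable_funM => //; apply/measurable_EFinP => //.
  by apply: measurableT_comp => //; exact: density_measurable.
apply: filterS sg => x /= -> _.
rewrite -!EFinM -EFinD lee_fin /g.
rewrite (_ : _ - _ = t * rho x - t * h x); last by ring.
by rewrite (le_trans (ler_normB _ _))// !(normrM t) (gtr0_norm t0) (ger0_norm (h0 x)).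
Qed.

(** An indicator equals its own square, so the integral under the norm is [lam B]. *)
Lemma indic_L2fun (B : set T) : measurable B -> (lam B < +oo)%E ->
  (fun x => (\1_B x : R)%:C%C) \in L2fun_pred lam.
Proof.
move=> mB Boo; rewrite inE; split => /=.
- exact: measurable_indic.
- exact: measurable_cst.
rewrite /finite_norm unlock /Lnorm poweR_lty//.
under eq_integral.
  move=> x _; rewrite /= expr0n/= addr0 sqrtr_sqr normr_id.
  rewrite (_ : _ `^ 2 = \1_B x); last first.
    by rewrite indicE; case: (_ \in _); rewrite ?normr1 ?powR1// normr0 powR0.
  over.
by rewrite integral_indic// setIT.
Qed.

End densities.

(** * Discontinuity of the projection policy over a sigma-finite measure *)

Section discontinuity.
Context d (T : measurableType d) (R : realType).
Variable lam : {sigma_finite_measure set T -> \bar R}.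

(** Slice [A] by a countable cover of sets of finite measure: if every slice were null, so would be
    [A]. *)
Lemma sigma_finite_pos_subset (A : set T) : measurable A -> (0 < lam A)%E ->
  exists B, [/\ B `<=` A, measurable B, (0 < lam B)%E & (lam B < +oo)%E].
Proof.
move=> mA A0; have [F TF Ffin] := sigma_finiteT lam.
apply: contrapT => noB.
suff A00 : lam A = 0%E by rewrite A00 ltxx in A0.
have -> : A = \bigcup_k (A `&` F k) by rewrite -setI_bigcupr -TF setIT.
apply/negligibleP.
  by apply: bigcupT_measurable => k; apply: measurableI => //; exact: (Ffin k).1.
apply: negligible_bigcup => k; have [mF Foo] := Ffin k.
have mAF : measurable (A `&` F k) by exact: measurableI.
apply/negligibleP => //; apply: contrapT => /eqP AF0; apply: noB.
exists (A `&` F k); split => //.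
  by rewrite lt0e AF0 measure_ge0.
by apply: le_lt_trans Foo; rewrite le_measure ?inE.
Qed.

Lemma restrict_policy_discontinuous (rho : density lam) :
  (0 < lam (zero_set rho))%E ->
  discontinuous_at_density (restrict_policy lam) rho.
Proof.
move=> /(sigma_finite_pos_subset (zero_set_measurable rho))[B [Bz mB B0 Boo]].
pose f : L2fun lam := MkL2fun (indic_L2fun mB Boo).
pose u := L2_class f; exists u => cu.
have u0 : u != 0.
  apply/eqP; rewrite -L2_class0 => /L2_eqP fae0.
  suff : lam B = 0%E by move=> BE; rewrite BE ltxx in B0.
  apply/negligibleP => //; apply: negligibleS fae0 => x Bx /= /eqP.
  by rewrite indicE mem_set// eq_complex/= oner_eq0.
have rho_u : restrict_policy lam rho u = 0.
  rewrite /= L2_restrictE -L2_class0; apply/L2_eqP; apply: aeW => x /=.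
  rewrite /restrict0; case: ifPn => //; rewrite inE /= => nz.
  by rewrite indicE memNset// => /Bz.
(* The tolerance is exactly the jump from [0], the image of [u] at [rho], to [u], its image at each
   nearby [sigma]. *)
pose e := L2norm (0 - u).
have e0 : 0 < e.
  rewrite lt0r L2norm_ge0 andbT; apply: contraNneq u0 => /L2norm_eq0/eqP.
  by rewrite sub0r oppr_eq0.
have [del del0 /= cdel] := cu e e0.
have [sigma [rs sB]] := density_perturbation mB B0 Boo Bz del0.
(* Only the density moves, so the distance between the inputs is [L1dist rho sigma]. *)
have := cdel (u, sigma); rewrite /d_oplus /= subrr L2norm0 add0r => /(_ rs).
have -> : restrict_policy lam sigma u = u.
  have Vu : u \in Vspace sigma.
    rewrite inE /Vspace /=.
    (* Membership in [Vspace] concerns the chosen representative of [u], which is the indicator of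
       [B] only almost everywhere. *)
    have /L2_eqP := L2_classK u; rewrite {2}/u.
    apply: filterS2 sB => x /= sx; rewrite /L2_repr => -> /= s0.
    by rewrite indicE memNset// => /sx; rewrite s0 eqxx.
  by rewrite (policy_restrict (restrict_policy lam) Vu) sharp_identity.
(* The output distance is [e] plus a nonnegative L^1 term, hence not below [e]. *)
rewrite rho_u -/e ltNge => /negP; apply.
by rewrite lerDl L1dist_ge0.
Qed.

End discontinuity.

Theorem proposition9p2 (R : realType) (n : nat) (n_gt0 : (0 < n)%N) :
  (exists P : extension_policy (identity_family (lebesgue_tuple R n)),
    forall rho : density (lebesgue_tuple R n),
      (0 < lebesgue_tuple R n (zero_set rho))%E ->
      discontinuous_at_density P rho) /\
  (exists P : extension_policy (identity_family (lebesgue_tuple R n)),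
    globally_lipschitz P).
Proof.
split.
  exists (restrict_policy (lebesgue_tuple R n)) => rho.
  exact: restrict_policy_discontinuous.
by exists (identity_policy (lebesgue_tuple R n)); exact: identity_policy_lipschitz.
Qed.
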